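(* Let $R$ be a commutative ring containing elements $p,q,\hbar,t_1,\dots,t_n$, and let $\mathcal M$ be the free $R$-module with basis the partitions $\nu\subseteq(n-k)^k$. For $1\le i\le k$ and $\nu\subseteq(n-k)^k$, with $c=\nu_i+k+1-i$, define $R$-linear operators by $$A^{h,h}_i(\nu)=t_c\nu+\sum_{\mu}w_{\mathtt h}(\mu/\nu)\,\mu,\quad A^{h,t}_i(\nu)=t_c\nu+\sum_{\mu}w_{\mathtt t}(\mu/\nu)\,\mu\quad(\mu/\nu\text{ a ribbon with head in row }i),$$ $$A^{t,h}_i(\nu)=t_c\nu+\sum_{\mu}w_{\mathtt h}(\mu/\nu)\,\mu,\quad A^{t,t}_i(\nu)=t_c\nu+\sum_{\mu}w_{\mathtt t}(\mu/\nu)\,\mu\quad(\mu/\nu\text{ a ribbon with tail in row }i),$$ and $$B^{h,h}_i(\nu)=t_c\nu+\sum_{\lambda}w_{\mathtt h}(\nu/\lambda)\,\lambda,\quad B^{h,t}_i(\nu)=t_c\nu+\sum_{\lambda}w_{\mathtt t}(\nu/\lambda)\,\lambda\quad(\nu/\lambda\text{ a ribbon with head in row }i),$$ $$B^{t,h}_i(\nu)=t_c\nu+\sum_{\lambda}w_{\mathtt h}(\nu/\lambda)\,\lambda,\quad B^{t,t}_i(\nu)=t_c\nu+\sum_{\lambda}w_{\mathtt t}(\nu/\lambda)\,\lambda\quad(\nu/\lambda\text{ a ribbon with tail in row }i),$$ all sums over partitions inside $(n-k)^k$, where for a ribbon $\eta$, $w_{\mathtt h}(\eta)=(\hbar-(p-q)t_{\mathtt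 h(\eta)})p^{\operatorname{ht}(\eta)-1}q^{\operatorname{wd}(\eta)-1}$ and $w_{\mathtt t}(\eta)=(\hbar-(p-q)t_{\mathtt t(\eta)})p^{\operatorname{ht}(\eta)-1}q^{\operatorname{wd}(\eta)-1}$. Then for all $\lambda,\mu\subseteq(n-k)^k$ and $0\le r\le k$, with all sums over $1\le i_1<\cdots<i_r\le k$: $$\sum A^{h,h}_{i_r}\cdots A^{h,h}_{i_1}(\lambda)=\sum A^{t,h}_{i_r}\cdots A^{t,h}_{i_1}(\lambda),\qquad \sum A^{h,t}_{i_r}\cdots A^{h,t}_{i_1}(\lambda)=\sum A^{t,t}_{i_r}\cdots A^{t,t}_{i_1}(\lambda),$$ $$\sum B^{h,h}_{i_1}\cdots B^{h,h}_{i_r}(\mu)=\sum B^{t,h}_{i_1}\cdots B^{t,h}_{i_r}(\mu),\qquad \sum B^{h,t}_{i_1}\cdots B^{h,t}_{i_r}(\mu)=\sum B^{t,t}_{i_1}\cdots B^{t,t}_{i_r}(\mu).$$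
   Context: Partitions $\nu\subseteq(n-k)^k$: $n-k\ge\nu_1\ge\dots\ge\nu_k\ge0$, identified with Young diagrams, rows numbered top to bottom. A ribbon is a nonempty connected skew shape $\eta=\mu/\lambda$ containing no $2\times2$ square; head = top-right box, tail = bottom-left box; $\operatorname{ht}(\eta)$, $\operatorname{wd}(\eta)$ are its numbers of rows and columns. If the head is in row $i$ and the tail in row $j$, $\mathtt h(\eta)=\mu_i+k+1-i$ and $\mathtt t(\eta)=\lambda_j+k+1-j$. *)

(* Defs.v *)
From HB Require Import structures.
From mathcomp Require Import all_boot all_order all_algebra.
Set Implicit Arguments. Unset Strict Implicit. Unset Printing Implicit Defensive.
Import GRing.Theory.
Local Open Scope ring_scope.

(* Partitions nu inside the k x (n-k) box, stored as the k-tuple of row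
   lengths (rows indexed 0..k-1, i.e. paper row i+1 is index i). *)
Definition is_decr (n k : nat) (f : {ffun 'I_k -> 'I_(n - k).+1}) : bool :=
  [forall i : 'I_k, forall j : 'I_k, (i <= j)%N ==> (f j <= f i)%N].

Definition part (n k : nat) := {f : {ffun 'I_k -> 'I_(n - k).+1} | is_decr f}.

Definition prow (n k : nat) (nu : part n k) (i : 'I_k) : nat := val (val nu i).

Section Ribbons.
Variables (n k : nat).
Implicit Types (mu la : part n k).

(* boxes: (row r, column c) with 0-indexed column c, i.e. paper column c+1 *)
Definition cell := ('I_k * 'I_(n - k))%type.

Definition in_skew mu la (x : cell) : bool :=
  (prow la x.1 <= x.2)%N && (x.2 < prow mu x.1)%N.

Definition cell_adj (x y : cell) : bool :=
  ((x.1 == y.1) && ((x.2.+1 == y.2 :> nat) || (y.2.+1 == x.2 :> nat)))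
  || ((x.2 == y.2) && ((x.1.+1 == y.1 :> nat) || (y.1.+1 == x.1 :> nat))).

Definition skew_rel mu la : rel cell :=
  fun x y => [&& in_skew mu la x, in_skew mu la y & cell_adj x y].

Definition is_ribbon mu la : bool :=
  [&& [forall i, prow la i <= prow mu i]%N,
      [exists x, in_skew mu la x],
      [forall x, forall y, in_skew mu la x ==> in_skew mu la y ==>
                            connect (skew_rel mu la) x y] &
      [forall x : cell, forall y : cell,
         ((y.1 == x.1.+1 :> nat) && (y.2 == x.2.+1 :> nat)) ==>
         ~~ [&& in_skew mu la x, in_skew mu la y,
                in_skew mu la (x.1, y.2) & in_skew mu la (y.1, x.2)]]].

Definition row_occ mu la (i : 'I_k) : bool := (prow la i < prow mu i)%N.

(* the head (top-right box) lies in row i: i is the topmost occupied row *)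
Definition head_row mu la (i : 'I_k) : bool :=
  row_occ mu la i && [forall j : 'I_k, (j < i)%N ==> ~~ row_occ mu la j].
(* the tail (bottom-left box) lies in row i: i is the bottommost occupied row *)
Definition tail_row mu la (i : 'I_k) : bool :=
  row_occ mu la i && [forall j : 'I_k, (i < j)%N ==> ~~ row_occ mu la j].

Definition ht mu la : nat := #|[set i : 'I_k | row_occ mu la i]|.
Definition wd mu la : nat :=
  #|[set c : 'I_(n - k) | [exists r : 'I_k, in_skew mu la (r, c)]]|.

(* h(mu/la) = mu_i + k + 1 - i (paper, 1-indexed head row i)
            = mu_i + k - i  (0-indexed head row i) *)
Definition hval mu la : nat :=
  if [pick i | head_row mu la i] is Some i then (prow mu i + (k - i))%N else 0%N.
(* t(mu/la) = la_j + k + 1 - j (paper, 1-indexed tail row j) *)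
Definition tval mu la : nat :=
  if [pick j | tail_row mu la j] is Some j then (prow la j + (k - j))%N else 0%N.

Variables (R : comPzRingType) (p q hb : R) (t : nat -> R).

Definition w_h mu la : R :=
  (hb - (p - q) * t (hval mu la)) * p ^+ (ht mu la).-1 * q ^+ (wd mu la).-1.
Definition w_t mu la : R :=
  (hb - (p - q) * t (tval mu la)) * p ^+ (ht mu la).-1 * q ^+ (wd mu la).-1.

Definition vec := {ffun part n k -> R}.
Definition basis (la : part n k) : vec := [ffun nu => (nu == la)%:R].

(* c = nu_i + k + 1 - i with paper (1-indexed) row; here 0-indexed i *)
Definition cval (nu : part n k) (i : 'I_k) : nat := (prow nu i + (k - i))%N.

(* A-type: nu |-> t_c nu + sum_{mu : mu/nu ribbon, rowcond} w(mu/nu) mu *)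
Definition opA (rowcond : part n k -> part n k -> 'I_k -> bool)
    (w : part n k -> part n k -> R) (i : 'I_k) (v : vec) : vec :=
  [ffun mu => \sum_nu v nu *
     ((if nu == mu then t (cval nu i) else 0)
      + (if is_ribbon mu nu && rowcond mu nu i then w mu nu else 0))].

(* B-type: nu |-> t_c nu + sum_{la : nu/la ribbon, rowcond} w(nu/la) la *)
Definition opB (rowcond : part n k -> part n k -> 'I_k -> bool)
    (w : part n k -> part n k -> R) (i : 'I_k) (v : vec) : vec :=
  [ffun la => \sum_nu v nu *
     ((if nu == la then t (cval nu i) else 0)
      + (if is_ribbon nu la && rowcond nu la i then w nu la else 0))].

Definition A_hh := opA head_row w_h.
Definition A_ht := opA head_row w_t.
Definition A_th := opA tail_row w_h.
Definition A_tt := opA tail_row w_t.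
Definition B_hh := opB head_row w_h.
Definition B_ht := opB head_row w_t.
Definition B_th := opB tail_row w_h.
Definition B_tt := opB tail_row w_t.

Definition incr (S : {set 'I_k}) : seq 'I_k := [seq i <- enum 'I_k | i \in S].

(* sum_{i_1<...<i_r} X_{i_r} ... X_{i_1}(la)  (i_1 applied first) *)
Definition sumA (X : 'I_k -> vec -> vec) (r : nat) (la : part n k) : vec :=
  \sum_(S : {set 'I_k} | #|S| == r) foldl (fun v i => X i v) (basis la) (incr S).
(* sum_{i_1<...<i_r} X_{i_1} ... X_{i_r}(mu)  (i_r applied first) *)
Definition sumB (X : 'I_k -> vec -> vec) (r : nat) (mu : part n k) : vec :=
  \sum_(S : {set 'I_k} | #|S| == r) foldr (fun i v => X i v) (basis mu) (incr S).

End Ribbons.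

(* Main.v *)
Require Import Defs.
From mathcomp Require Import all_boot all_order all_algebra.
From mathcomp Require Import zify.
Set Implicit Arguments. Unset Strict Implicit. Unset Printing Implicit Defensive.
Import GRing.Theory.
Local Open Scope ring_scope.

(* Encode a partition by the particle configuration of its row positions
   [nu_i + k + 1 - i].  Adding a ribbon with tail in row [j] and head in row [i]
   is a jump of one particle from the position of row [j] of [nu] to the empty
   position of row [i] of [mu]; [ht - 1] and [wd - 1] count the particles and the
   holes jumped over, so the weight depends only on source, target and [ht].
   Let [X a b] be the jump from [a] to [b], with [X a a] the diagonal term.

   Both kinds of products then become sums over positions instead of rows: the
   head operators give ordered products of [sum_a X a b] over distinct targets
   [b], the tail operators ordered products of [sum_b X a b] over distinct sources
   [a].  Reordering by source or by target only exchanges nested jumps; these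
   commute because the outer jump does not change the number of particles the
   inner one passes, and conversely.  Successive jumps sharing a source or a
   target multiply to zero.  Finally, the [B] operators are the transposes of the [A] operators. *)

(** * Ordered elementary symmetric sums in a noncommutative ring *)

Section OrderedElementarySums.
Variable A : pzRingType.
Implicit Types (f g : nat -> A).

Fixpoint osym f (n r : nat) : A :=
  match r, n with
  | 0, _ => 1
  | _.+1, 0 => 0
  | r'.+1, n'.+1 => osym f n' r + osym f n' r' * f n'
  end.

Lemma osym0 f n : osym f n 0 = 1. Proof. by case: n. Qed.

Lemma osymS f n r : osym f n.+1 r.+1 = osym f n r.+1 + osym f n r * f n.
Proof. by []. Qed.

Lemma eq_osym f g n r :
  (forall i, (i < n)%N -> f i = g i) -> osym f n r = osym g n r.
Proof.
elim: n r => [|n IH] [|r] // fg.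
rewrite !osymS !IH ?fg // => i ltin; apply: fg; lia.
Qed.

Lemma osym_last f n r : osym f n r.+1 = \sum_(j < n) osym f j r * f j.
Proof. by elim: n => [|n IH]; rewrite ?big_ord0 // osymS IH big_ord_recr. Qed.

Lemma osym_subsets (T : finType) (s : seq T) (g : T -> A) f r :
  uniq s -> [seq f i | i <- iota 0 (size s)] = map g s ->
  \sum_(S : {set T} | (S \subset s) && (#|S| == r))
     \prod_(i <- s | i \in S) g i = osym f (size s) r.
Proof.
elim/last_ind: s r => [|s x IH] r.
  move=> _ _; under eq_bigr do rewrite big_nil.
  have sub0 (S : {set T}) : (S \subset [::]) = (S == set0).
    by rewrite -subset0; apply: eq_subset_r => i; rewrite inE.
  case: r => [|r].
    rewrite osym0 (big_pred1 set0) // => S; rewrite sub0 /=.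
    by case: eqP => [->|]; rewrite ?cards0.
  rewrite big_pred0 // => S; rewrite sub0.
  by case: eqP => [->|//]; rewrite cards0.
rewrite rcons_uniq size_rcons => /andP[xs us].
rewrite -addn1 iotaD add0n map_cat /= cats1 map_rcons.
move=> /eqP; rewrite eqseq_rcons => /andP[/eqP fs /eqP fx].
have subx (S : {set T}) : x \notin S -> (S \subset rcons s x) = (S \subset s).
  move=> xS; apply/subsetP/subsetP => h i iS; have := h i iS.
    rewrite mem_rcons inE => /orP[/eqP ix|//].
    by rewrite -ix iS in xS.
  by rewrite mem_rcons inE orbC => ->.
rewrite (bigID (fun S : {set T} => x \in S)) /= addrC.
have E1 m : \sum_(S : {set T} | [&& S \subset rcons s x, #|S| == m & x \notin S])
      \prod_(i <- rcons s x | i \in S) g i = osym f (size s) m.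
  rewrite -IH //; apply: eq_big => [S|S].
    case: (boolP (x \in S)) => xS; last by rewrite subx // andbT.
    rewrite !andbF; apply/esym/negP => /andP[/subsetP h _].
    by rewrite (h _ xS) in xs.
  by case/and3P=> _ _ xS; rewrite big_rcons (negbTE xS) /= mulr1.
under eq_bigl do rewrite -andbA.
rewrite E1 addn1; case: r => [|r].
  rewrite !osym0 big_pred0 ?addr0 // => S; rewrite cards_eq0.
  by case: (S =P set0) => [->|]; rewrite ?inE ?andbF.
rewrite osymS; congr (_ + _).
rewrite -IH // mulr_suml.
rewrite (reindex_onto (fun S : {set T} => x |: S) (fun S => S :\ x)) /=; last first.
  by move=> S /andP[_ xS]; rewrite setD1K.
apply: eq_big => [S|S].
  rewrite setU11 andbT; case: (boolP (x \in S)) => xS.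
    apply/idP/idP => [/andP[_ /eqP h]|/andP[/subsetP h _]].
      by move: xS; rewrite -h !inE eqxx.
    by rewrite (h _ xS) in xs.
  rewrite setU1K // eqxx andbT cardsU1 xS add1n eqSS; congr (_ && _).
  rewrite -(subx _ xS); apply/subsetP/subsetP => h i; last first.
    by rewrite !inE => /orP[/eqP->|/h//]; rewrite mem_rcons inE eqxx.
  by move=> iS; apply: h; rewrite !inE iS orbT.
case/andP => /andP[/andP[_ _] _] /eqP h.
have xS : x \notin S by rewrite -h !inE eqxx.
rewrite big_rcons /= setU11 fx; congr (_ * _).
rewrite big_seq_cond [RHS]big_seq_cond; apply: eq_bigl => i.
rewrite !inE; case: (i =P x) => [->|//]; by rewrite (negbTE xs).
Qed.

Lemma osym_ord k (g : 'I_k -> A) f r : (forall i : 'I_k, f i = g i) ->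
  \sum_(S : {set 'I_k} | #|S| == r) \prod_(i <- incr S) g i = osym f k r.
Proof.
move=> fg; have := @osym_subsets _ (enum 'I_k) g f r (enum_uniq _).
rewrite size_enum_ord => <-; last first.
  by rewrite -val_enum_ord -map_comp; apply: eq_map.
apply: eq_big => [S|S _]; last by rewrite /incr big_filter.
suff -> : S \subset enum 'I_k by [].
by apply/subsetP => i _; rewrite mem_enum.
Qed.

(* The chains that contribute to either side are monotone in both indices. *)
Lemma osym_exchange (Q : nat -> nat -> A) k n r :
  (forall i1 b1 i2 b2, (i1 < i2)%N != (b1 < b2)%N -> Q i1 b1 * Q i2 b2 = 0) ->
  osym (fun i => \sum_(b < n) Q i b) k r = osym (fun b => \sum_(i < k) Q i b) n r.
Proof.
case: r => [|r]; first by rewrite !osym0.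
(* [G r i b] sums the products over chains of [r + 1] pairs, strictly increasing in both indices and
   ending at [(i, b)]; both sides are sums of [G] over its endpoints. *)
move=> Q0; pose fix G r i b {struct r} : A :=
  if r is r'.+1 then (\sum_(i' < i) \sum_(b' < b) G r' i' b') * Q i b else Q i b.
have GQ m i b i' b' : (i < i')%N != (b < b')%N -> G m i b * Q i' b' = 0.
  by move=> /Q0 h; case: m => [|m] //=; rewrite -mulrA h mulr0.
have widen m (F : nat -> A) N b : (b <= N)%N ->
    (forall c, (b <= c)%N -> F c * m = 0) ->
    (\sum_(c < N) F c) * m = (\sum_(c < b) F c) * m.
  move=> bN F0; rewrite !mulr_suml [RHS](big_ord_widen N (fun c => F c * m)) //.
  rewrite [LHS](bigID (fun c : 'I_N => c < b)%N) /= [X in _ + X]big1 ?addr0 // => c.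
  by rewrite -leqNgt => /F0.
have rowG m i : (i < k)%N -> \sum_(b < n) G m i b =
    osym (fun i => \sum_(b < n) Q i b) i m * \sum_(b < n) Q i b.
  elim: m i => [|m IH] i ik; first by rewrite osym0 mul1r.
  rewrite osym_last mulr_sumr; apply: eq_bigr => b _ /=.
  rewrite !mulr_suml; apply: eq_bigr => i' _.
  rewrite -IH ?(ltn_trans (ltn_ord i')) // (widen _ _ n b) // 1?ltnW // => c bc.
  by apply: GQ; rewrite ltn_ord ltnNge bc.
have colG m b : (b < n)%N -> \sum_(i < k) G m i b =
    osym (fun b => \sum_(i < k) Q i b) b m * \sum_(i < k) Q i b.
  elim: m b => [|m IH] b ib; first by rewrite osym0 mul1r.
  rewrite osym_last mulr_sumr; apply: eq_bigr => i _ /=.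
  rewrite exchange_big /= !mulr_suml; apply: eq_bigr => b' _.
  rewrite -IH ?(ltn_trans (ltn_ord b')) //.
  rewrite (widen _ (fun c => G m c b') k i) // 1?ltnW // => c bc.
  by apply: GQ; rewrite ltn_ord ltnNge bc.
rewrite !osym_last.
under eq_bigr do rewrite -rowG //.
rewrite exchange_big /=; apply: eq_bigr => b _; exact: colG.
Qed.

(* [X a b] stands for a particle jumping from site [a] to site [b <= a].  The
   left side performs the jumps in the order of their targets, the right side
   in the order of their sources; the induction adds the last source. *)
Lemma osym_targets_sources (X : nat -> nat -> A) n r :
  (forall m b c, (c < b <= m)%N -> X m c * X m b = 0) ->
  (forall m a b c, (c < b)%N -> (b <= a)%N -> (a < m)%N ->
     X m c * X a b = X a b * X m c) ->
  (forall m a b, (b <= a < m)%N -> X a b * X m b = 0) ->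
  osym (fun b => \sum_(b <= a < n) X a b) n r =
  osym (fun a => \sum_(b < a.+1) X a b) n r.
Proof.
move=> R1 R2 R3; elim: n r => [|n IH] r; first by case: r.
(* [Y m b] collects the jumps to [b] from sources below [m]; [J b] collects those of the new source
   [n] to targets below [b]. *)
pose Y m b := \sum_(b <= a < m) X a b.
pose J b := \sum_(c < b) X n c.
have YS b : (b <= n)%N -> Y n.+1 b = Y n b + X n b by move=> bn; rewrite /Y big_nat_recr.
have JX b : (b <= n)%N -> J b * X n b = 0.
  move=> bn; rewrite mulr_suml big1 // => c _; apply: R1; by rewrite ltn_ord.
have JY b : (b <= n)%N -> J b * Y n b = Y n b * J b.
  move=> bn; rewrite mulr_suml mulr_sumr; apply: eq_bigr => c _.
  rewrite mulr_sumr mulr_suml; apply: eq_big_nat => a /andP[ba an].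
  by apply: R2.
have YX b : Y n b * X n b = 0.
  by rewrite mulr_suml big_nat big1 // => a h; apply: R3.
(* Source [n] is used at most once, and its jump moves to the end of the product because it commutes
   with the jumps to later targets; [YX] removes the repeated targets this creates. *)
have key b s : (b <= n.+1)%N ->
    osym (Y n.+1) b s.+1 = osym (Y n) b s.+1 + osym (Y n) b s * J b.
  elim: b s => [|b IHb] s bn; first by rewrite /= /J big_ord0 mulr0 addr0.
  have b_le : (b <= n)%N by lia.
  have JS : J b.+1 = J b + X n b by rewrite /J big_ord_recr.
  rewrite !osymS IHb 1?ltnW // YS // JS.
  case: s => [|s].
    by rewrite !osym0 !mul1r -!addrA; congr (_ + _); rewrite addrCA.
  rewrite IHb 1?ltnW // osymS !mulrDl !mulrDr -!mulrA JX // JY // YX // !mulr0 !addr0.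
  rewrite -!addrA; congr (_ + _).
  exact: addrCA.
case: r => [|r] //.
(* [Y n n] is an empty sum, so the last target adds nothing. *)
have trunc s : osym (Y n) n.+1 s = osym (Y n) n s.
  case: s => [|s]; first by rewrite !osym0.
  by rewrite osymS /Y big_geq // mulr0 addr0.
by rewrite key // !trunc !IH.
Qed.

End OrderedElementarySums.

(** * Partitions as particle configurations *)

Section Positions.
Local Open Scope nat_scope.
Lemma card_ord_interval m lo hi : hi <= m -> #|[set c : 'I_m | lo <= c < hi]| = hi - lo.
Proof.
move=> him; rewrite -sum1_card.
under eq_bigl do rewrite inE.
rewrite -(big_ord_widen_cond m (fun c => lo <= c) (fun=> 1)) //.
rewrite -(big_mkord (fun c => lo <= c) (fun=> 1)).
case: (leqP lo hi) => h.
  rewrite (big_cat_nat (n := lo)) //= big_nat_cond big_pred0 ?add0n; last by move=> c; lia.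
  rewrite big_nat_cond (eq_bigl (fun c => (lo <= c < hi) && true)); last by move=> c; lia.
  by rewrite -big_nat_cond sum_nat_const_nat muln1.
by rewrite big_nat_cond big_pred0; [lia | move=> c; lia].
Qed.

Variables (n k : nat).
Implicit Types (mu nu la : part n k).

Definition rowlen nu (r : nat) : nat :=
  if insub r is Some i then prow nu i else 0.

Lemma rowlen_ord nu (i : 'I_k) : rowlen nu i = prow nu i.
Proof. by rewrite /rowlen valK. Qed.

Lemma rowlen_default nu r : k <= r -> rowlen nu r = 0.
Proof. by move=> kr; rewrite /rowlen insubN // -leqNgt. Qed.

Lemma rowlen_le nu r : rowlen nu r <= n - k.
Proof.
rewrite /rowlen; case: insubP => [i _ _|_] //.
by rewrite /prow -ltnS; apply: (valP (val nu i)).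
Qed.

Lemma rowlen_anti nu r s : r <= s -> rowlen nu s <= rowlen nu r.
Proof.
move=> rs; case: (ltnP s k) => sk; last by rewrite rowlen_default.
have rk : r < k by lia.
rewrite -[s]/(val (Ordinal sk)) -[r]/(val (Ordinal rk)) !rowlen_ord.
by have /forallP/(_ (Ordinal rk))/forallP/(_ (Ordinal sk))/implyP := valP nu; apply.
Qed.

(* [site nu i] is [n - c] for the paper's position [c] of row [i], so sites grow
   downwards.  Past row [k] the sites are filled consecutively from [n] on, which
   makes the counting lemmas below free of boundary cases. *)
Definition site nu (r : nat) : nat := n - k - rowlen nu r + r.

Lemma site_ltn nu r s : r < s -> site nu r < site nu s.
Proof. by move=> rs; have := @rowlen_anti nu r s; rewrite /site; lia. Qed.

Lemma site_lt nu r s : (site nu r < site nu s) = (r < s).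
Proof.
case: (ltngtP r s) => [h|h|->]; [|have := site_ltn nu h|]; last lia.
  by rewrite site_ltn.
lia.
Qed.

Lemma site_large nu r : k <= r -> site nu r = n - k + r.
Proof. by move=> kr; rewrite /site rowlen_default // subn0. Qed.

(** The number of particles at sites below [y]; stopping at row [y] loses none because
    [r <= site nu r]. *)
Definition cnt nu (y : nat) : nat := \sum_(r < y) (site nu r < y).

(** Sites increase strictly with the row, so the rows with site below [y] form an initial segment,
    of length [cnt nu y]. *)
Lemma site_lt_cnt nu r y : (site nu r < y) = (r < cnt nu y).
Proof.
have le_site s : s <= site nu s by rewrite /site leq_addl.
have mono s s' : s <= s' -> site nu s <= site nu s'.
    by move=> h; rewrite leqNgt site_lt -leqNgt.
have sum1 m : \sum_(s < m) 1 = m by rewrite sum1_card card_ord.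
have cntE m : m <= y -> \sum_(s < y) (s < m) = m.
  move=> my; rewrite -[RHS](sum1 m) [RHS](big_ord_widen y (fun=> 1)) // [RHS]big_mkcond /=.
  by apply: eq_bigr => i _; case: ifP.
have [lt|ge] := ltnP (site nu r) y.
  apply/esym; rewrite -(cntE r.+1); last by have := le_site r; lia.
  apply: leq_sum => s _; case: ltnP => //; rewrite ltnS => sr.
  by have := mono _ _ sr; case: ltnP => //; lia.
apply/esym/negbTE; rewrite -leqNgt.
case: (leqP r y) => ry; last first.
  apply: (leq_trans (n := \sum_(s < y) 1)); last by rewrite sum1 ltnW.
  by apply: leq_sum => s _; case: (_ < _).
rewrite -[X in _ <= X](cntE r) //; apply: leq_sum => s _.
case: (ltnP s r) => sr; first by case: (_ < _).
by have := mono _ _ sr; case: (ltnP (site nu s)); lia.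
Qed.

Lemma cnt_site nu r : cnt nu (site nu r) = r.
Proof.
have := site_lt_cnt nu r (site nu r); rewrite ltnn => /esym/negbT.
rewrite -leqNgt => h; apply/eqP; rewrite eqn_leq h /=.
case: r h => // r h; rewrite -site_lt_cnt; exact: site_ltn.
Qed.

Lemma cnt_siteS nu r : cnt nu (site nu r).+1 = r.+1.
Proof.
apply/eqP; rewrite eqn_leq -site_lt_cnt ltnSn andbT leqNgt -site_lt_cnt ltnS -ltnNge.
exact: site_ltn.
Qed.

Lemma site_eq nu r x : cnt nu x = r -> cnt nu x.+1 = r.+1 -> site nu r = x.
Proof.
move=> h1 h2; have := site_lt_cnt nu r x; have := site_lt_cnt nu r x.+1.
rewrite h1 h2; lia.
Qed.

Lemma cnt0 nu : cnt nu 0 = 0. Proof. exact: big_ord0. Qed.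

Lemma cnt_le nu y z : y <= z -> cnt nu y <= cnt nu z.
Proof.
move=> yz; rewrite leqNgt -site_lt_cnt -leqNgt.
have := site_lt_cnt nu (cnt nu z) z; rewrite ltnn; lia.
Qed.

Lemma cnt_leS nu y : cnt nu y <= cnt nu y.+1 <= (cnt nu y).+1.
Proof.
rewrite cnt_le //= leqNgt -site_lt_cnt -leqNgt.
have := site_lt_cnt nu (cnt nu y) y; rewrite ltnn => h.
have := site_ltn nu (ltnSn (cnt nu y)); lia.
Qed.

Lemma cnt_inj mu nu : cnt mu =1 cnt nu -> mu = nu.
Proof.
move=> h; apply: val_inj; apply/ffunP => i; apply: val_inj.
rewrite -[LHS]/(prow mu i) -[RHS]/(prow nu i) -!rowlen_ord.
have : site mu i = site nu i by apply: site_eq; rewrite h ?cnt_site ?cnt_siteS.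
by rewrite /site; have := rowlen_le mu i; have := rowlen_le nu i; lia.
Qed.

Hypothesis hkn : k <= n.

Lemma site_lt_n nu r : (site nu r < n) = (r < k).
Proof.
rewrite (_ : n = site nu k) ?site_lt //; rewrite site_large //; lia.
Qed.

Lemma cval_site nu (i : 'I_k) : cval nu i = n - site nu i.
Proof.
rewrite /cval /site -rowlen_ord; have := rowlen_le nu i.
have := ltn_ord i; lia.
Qed.

Lemma cnt_large nu y : n <= y -> cnt nu y = y - (n - k).
Proof.
move=> ny; have e : y = site nu (y - (n - k)) by rewrite site_large; lia.
by rewrite {1}e cnt_site.
Qed.

(** Allows a partition to be built from its counting function: particles sit where [f] steps up, and
    increments of 0 or 1 put at most one on each site. *)
Lemma cnt_surj (f : nat -> nat) :
  f 0 = 0 -> (forall y, f y <= f y.+1 <= (f y).+1) ->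
  (forall y, n <= y -> f y = y - (n - k)) -> exists nu, cnt nu =1 f.
Proof.
move=> f0 fS fn.
have ex i : exists y, i < f y by exists (n + i).+1; rewrite fn; lia.
have px i : {x | f x = i & f x.+1 = i.+1}.
  (* Particle [i] sits just below the least [y] with [i < f y]. *)
  case: (ex_minnP (ex i)) => -[|y]; first by rewrite f0.
  move=> h mn; exists y; have := fS y; have := mn y; case: (ltnP i (f y)); lia.
pose x i := s2val (px i).
have fx i : f (x i) = i := s2valP (px i).
have fxS i : f (x i).+1 = i.+1 := s2valP' (px i).
have fle y d : f y <= f (y + d) <= f y + d.
  elim: d => [|d IH]; first by rewrite !addn0 leqnn.
  by rewrite addnS; have := fS (y + d); lia.
have xle i j : i <= j -> x i <= x j.
  move=> ij; rewrite leqNgt; apply/negP => h.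
  have := fle (x j).+1 (x i - (x j).+1); rewrite subnKC // fx fxS; lia.
have xi i : i <= x i by have := fle 0 (x i); rewrite add0n fx f0; lia.
have xij i j : i <= j -> x i - i <= x j - j.
  move=> ij; have := fle (x i) (x j - x i); rewrite subnKC ?xle // !fx.
  have := xi i; have := xi j; have := xle _ _ ij; lia.
have xbig i : k <= i -> x i = n - k + i.
  move=> ki; have nx : n <= x i.
    rewrite leqNgt; apply/negP => h.
    have := fle (x i).+1 (n - (x i).+1); rewrite subnKC // fxS (fn n) //; lia.
  have := fn _ nx; rewrite fx; lia.
have xn i : x i - i <= n - k.
  case: (leqP k i) => ki; first by rewrite xbig //; lia.
  by have := xij _ _ (ltnW ki); rewrite (xbig k) //; lia.
(* This solves [site nu i = x i] for the row length; [xi] and [xn] make the truncated subtractions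
   exact. *)
pose g : {ffun 'I_k -> 'I_(n - k).+1} := [ffun i : 'I_k => inord (n - k - (x i - i))].
have gE (i : 'I_k) : g i = n - k - (x i - i) :> nat.
  by rewrite ffunE inordK // ltnS leq_subr.
have gd : is_decr g.
  apply/forallP => i; apply/forallP => j; apply/implyP => ij.
  by rewrite !gE; have := xij _ _ ij; lia.
pose nu : part n k := exist _ g gd; exists nu.
have siteE r : site nu r = x r.
  rewrite /site; case: (ltnP r k) => rk; last by rewrite rowlen_default // xbig // subn0.
  rewrite [rowlen nu r](rowlen_ord nu (Ordinal rk)) [prow _ _]gE /=.
  have := xn r; have := xi r; lia.
move=> y; apply/eqP; rewrite eqn_leq; apply/andP; split.
  rewrite leqNgt -site_lt_cnt siteE; apply/negP => h.
  have := fle (x (f y)).+1 (y - (x (f y)).+1); rewrite subnKC // fxS; lia.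
rewrite leqNgt; apply/negP => h.
have : ~~ (site nu (cnt nu y) < y) by rewrite site_lt_cnt ltnn.
rewrite siteE -leqNgt => h2.
have := fle y (x (cnt nu y) - y); rewrite subnKC // fx; lia.
Qed.

(* The particle at site [a] jumps to the empty site [b < a]: in terms of [cnt],
   both the occupancy conditions and the rest of the configuration are encoded
   in one linear relation. *)
Definition hop a b nu mu : bool :=
  (b < a < n) && [forall y : 'I_n.+1, cnt mu y == cnt nu y + (b < y <= a)].

Lemma hopP a b nu mu :
  reflect ([/\ b < a, a < n & forall y, cnt mu y = cnt nu y + (b < y <= a)])
          (hop a b nu mu).
Proof.
apply: (iffP andP) => [[/andP[ba an] /forallP h]|[ba an h]].
  split=> // y; case: (ltnP y n.+1) => yn; first exact/eqP/(h (Ordinal yn)).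
  by rewrite !cnt_large; lia.
by rewrite ba an; split=> //; apply/forallP => y; rewrite h.
Qed.

(** Across [b] the increment of the count grows by 1 while staying in {0, 1}: so [b] is empty in
    [nu] and occupied in [mu]. *)
Lemma hop_site_target a b nu mu : hop a b nu mu -> site mu (cnt nu b) = b.
Proof.
case/hopP => ba an h; apply: site_eq; have := h b; have := h b.+1;
have := cnt_leS mu b; have := cnt_leS nu b; lia.
Qed.

Lemma hop_site_source a b nu mu : hop a b nu mu -> site nu (cnt nu a) = a.
Proof.
case/hopP => ba an h; apply: site_eq => //; have := h a; have := h a.+1;
have := cnt_leS mu a; have := cnt_leS nu a; lia.
Qed.

(** Each particle passed gains one particle at a smaller site, so its row index grows by one;
    particles outside the interval keep theirs. *)
Lemma hop_sites a b nu mu : hop a b nu mu ->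
  [/\ cnt nu b <= cnt nu a < k,
      forall r, r < cnt nu b -> site mu r = site nu r,
      forall r, cnt nu a < r -> site mu r = site nu r &
      forall r, cnt nu b <= r < cnt nu a -> site mu r.+1 = site nu r].
Proof.
move=> hp; have sa := hop_site_source hp; have sb := hop_site_target hp.
case/hopP: (hp) => ba an h; split.
- by rewrite (cnt_le _ (ltnW ba)) /= -(site_lt_n nu) sa.
- move=> r; rewrite -site_lt_cnt => hr; apply: site_eq.
    by rewrite h cnt_site; lia.
  by rewrite h cnt_siteS; lia.
- move=> r hr; have : ~~ (r < cnt nu a.+1) by rewrite -sa cnt_siteS; lia.
  rewrite -site_lt_cnt => hr2; apply: site_eq.
    by rewrite h cnt_site; lia.
  by rewrite h cnt_siteS; lia.
- move=> r /andP[]; rewrite leqNgt -!site_lt_cnt -leqNgt => h1 h2.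
  have ne : site nu r != b.
    apply/eqP => e; have := cnt_site nu r; have := cnt_siteS nu r; rewrite e => e1 e2.
    have := h b; have := h b.+1; have := cnt_leS mu b; lia.
  apply: site_eq.
    by rewrite h cnt_site; lia.
  by rewrite h cnt_siteS; lia.
Qed.

(** The four sites are distinct, so every increment of an intermediate count agrees with that of [x]
    or of [y], hence is 0 or 1, and [cnt_surj] applies in either order. *)
Lemma hop_nested (x y : part n k) m c a b : c < b -> b < a -> a < m -> m < n ->
  (forall s, cnt y s = cnt x s + (c < s <= m) + (b < s <= a)) ->
  (exists2 z, hop m c x z & hop a b z y) /\
  (exists2 z, hop a b x z & hop m c z y).
Proof.
move=> cb ba am mn h; split.
  have [||s ns|z zE] := @cnt_surj (fun s => cnt x s + (c < s <= m)).
  - by rewrite cnt0.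
  - move=> s; have := h s; have := h s.+1.
    have := cnt_leS x s; have := cnt_leS y s; lia.
  - by rewrite cnt_large //; lia.
  by exists z; apply/hopP; split=> //; [lia | lia | move=> s; rewrite h zE].
have [||s ns|z zE] := @cnt_surj (fun s => cnt x s + (b < s <= a)).
- by rewrite cnt0.
- move=> s; have := h s; have := h s.+1.
  have := cnt_leS x s; have := cnt_leS y s; lia.
- by rewrite cnt_large //; lia.
by exists z; apply/hopP; split=> //; [lia | lia | move=> s; rewrite h zE addnAC].
Qed.

End Positions.

(** * Ribbons as jumps of a single particle *)

Section RibbonRows.
Local Open Scope nat_scope.
Variables (n k : nat).
Implicit Types (mu nu : part n k).

(** Row-length form of a ribbon with head in row [i] and tail in row [j]: the third clause says that
    consecutive rows share exactly one column. *)
Definition ribbon_rows i j nu mu : Prop :=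
  [/\ i <= j < k,
      forall r, (r < i) || (j < r) -> rowlen mu r = rowlen nu r,
      forall r, i <= r < j -> rowlen mu r.+1 = (rowlen nu r).+1 &
      rowlen nu i < rowlen mu i].

Lemma row_occE nu mu (r : 'I_k) : row_occ mu nu r = (rowlen nu r < rowlen mu r).
Proof. by rewrite /row_occ -!rowlen_ord. Qed.

Lemma in_skewE nu mu (r : 'I_k) (c : 'I_(n - k)) :
  in_skew mu nu (r, c) = (rowlen nu r <= c < rowlen mu r).
Proof. by rewrite /in_skew -!rowlen_ord. Qed.

Lemma skew_rel_sym nu mu : symmetric (skew_rel mu nu).
Proof.
move=> x y; rewrite /skew_rel andbCA; congr [&& _, _ & _].
rewrite /cell_adj [x.1 == y.1]eq_sym [x.2 == y.2]eq_sym.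
by congr (_ && _ || _ && _); apply: orbC.
Qed.

Lemma row_connect nu mu (r : 'I_k) (c c' : 'I_(n - k)) :
  in_skew mu nu (r, c) -> in_skew mu nu (r, c') ->
  connect (skew_rel mu nu) (r, c) (r, c').
Proof.
wlog cc : c c' / c <= c' => [wl|] h h'.
  case: (leqP c c') => [/wl|/ltnW /wl]; first exact.
  by rewrite (sym_connect_sym (@skew_rel_sym nu mu)); apply.
have [d dE] : exists d, d = c' - c by exists (c' - c).
elim: d c cc h dE => [|d IH] c cc h dE.
  by have -> : c = c' by apply: val_inj => /=; lia.
have cS : c.+1 < n - k by have := ltn_ord c'; lia.
have hS : in_skew mu nu (r, Ordinal cS) by move: h h'; rewrite !in_skewE /=; lia.
apply: (connect_trans (y := (r, Ordinal cS))); last by apply: IH => //=; lia.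
by apply: connect1; rewrite /skew_rel h hS /cell_adj /= !eqxx.
Qed.

Lemma rows_occ i j nu mu r : ribbon_rows i j nu mu ->
  (rowlen nu r < rowlen mu r) = (i <= r <= j).
Proof.
case=> ij out mid top.
have [lti|gei] := ltnP r i; first by rewrite out ?lti //; lia.
have [ltj|gej] := ltnP j r; first by rewrite out ?ltj ?orbT //; lia.
have [->|nri] := eqVneq r i; first by lia.
have := mid r.-1; rewrite prednK; last by lia.
have := @rowlen_anti _ _ nu r.-1 r; lia.
Qed.

Lemma rows_ribbon i j nu mu : ribbon_rows i j nu mu -> is_ribbon mu nu.
Proof.
move=> rr; have occ r := rows_occ r rr; case: (rr) => ij out mid top.
have ik : i < k by lia.
have jk : j < k by lia.
have cell_in r : i <= r <= j -> rowlen nu r < n - k.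
  by rewrite -occ; have := rowlen_le mu r; lia.
have rk r : i <= r <= j -> r < k by lia.
apply/and4P; split.
- apply/forallP => r; rewrite -!rowlen_ord.
  by have := occ r; case: (boolP (i <= r <= j)) => [_|h _]; [lia | rewrite out; lia].
- apply/existsP; exists (Ordinal ik, Ordinal (cell_in i ltac:(lia))).
  by rewrite in_skewE /= leqnn.
- have csym := sym_connect_sym (@skew_rel_sym nu mu).
  (* Every box is joined to [o], the leftmost box of the tail row, by descending one row at a time
     through the shared columns. *)
  pose o : cell n k := (Ordinal jk, Ordinal (cell_in j ltac:(lia))).
  have oin : in_skew mu nu o by rewrite in_skewE /= leqnn occ; lia.
  have to_o d (x : cell n k) :
      j - x.1 = d -> in_skew mu nu x -> connect (skew_rel mu nu) x o.
    elim: d x => [|d IH] [r c] /= rd xin.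
      have rE : r = Ordinal jk.
        apply: val_inj => /=; move: xin; rewrite in_skewE => h.
        have : i <= r <= j by rewrite -occ; lia.
        lia.
      rewrite rE in xin *; exact: row_connect.
    have ro : i <= r <= j by rewrite -occ; move: xin; rewrite in_skewE; lia.
    have rSk : r.+1 < k by lia.
    pose e : 'I_(n - k) := Ordinal (cell_in r ro).
    have ein : in_skew mu nu (r, e) by rewrite in_skewE /= leqnn occ.
    have e'in : in_skew mu nu (Ordinal rSk, e).
      by rewrite in_skewE /= mid ?(rowlen_anti nu (leqnSn r)) //; lia.
    apply: (connect_trans (y := (r, e))); first exact: row_connect.
    apply: (connect_trans (y := (Ordinal rSk, e))); last by apply: IH => //=; lia.
    by apply: connect1; rewrite /skew_rel ein e'in /cell_adj /= !eqxx orbT.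
  apply/forallP => x; apply/forallP => y; apply/implyP => xin; apply/implyP => yin.
  apply: (connect_trans (y := o)); first exact: to_o xin.
  by rewrite csym; apply: to_o yin.
- apply/forallP => -[r c]; apply/forallP => -[r' c'].
  apply/implyP => /= /andP[/eqP e1 /eqP e2].
  rewrite !in_skewE; apply/negP => /and4P[h1 h2 h3 h4].
  have o1 : i <= r <= j by rewrite -occ; lia.
  have o2 : i <= r' <= j by rewrite -occ; lia.
  have := mid r; rewrite e1 in h2; lia.
Qed.

Lemma rows_head i j nu mu (r : 'I_k) : ribbon_rows i j nu mu ->
  head_row mu nu r = (r == i :> nat).
Proof.
move=> rr; have occ s := rows_occ s rr; case: (rr) => ij _ _ _.
have ik : i < k by lia.
apply/andP/eqP => [[]|ri].
  rewrite row_occE occ => h /forallP/(_ (Ordinal ik)) /=.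
  by rewrite row_occE occ /=; lia.
split; first by rewrite row_occE occ; lia.
by apply/forallP => s; apply/implyP => sr; rewrite row_occE occ; lia.
Qed.

Lemma rows_tail i j nu mu (r : 'I_k) : ribbon_rows i j nu mu ->
  tail_row mu nu r = (r == j :> nat).
Proof.
move=> rr; have occ s := rows_occ s rr; case: (rr) => ij _ _ _.
have jk : j < k by lia.
apply/andP/eqP => [[]|rj].
  rewrite row_occE occ => h /forallP/(_ (Ordinal jk)) /=.
  by rewrite row_occE occ /=; lia.
split; first by rewrite row_occE occ; lia.
by apply/forallP => s; apply/implyP => sr; rewrite row_occE occ; lia.
Qed.

Lemma rows_ht i j nu mu : ribbon_rows i j nu mu -> ht mu nu = (j - i).+1.
Proof.
move=> rr; have occ s := rows_occ s rr; case: (rr) => ij _ _ _.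
rewrite /ht (_ : [set r | _] = [set r : 'I_k | i <= r < j.+1]).
  by rewrite card_ord_interval; lia.
by apply/setP => r; rewrite !inE row_occE occ.
Qed.

Lemma rows_wd i j nu mu : ribbon_rows i j nu mu -> wd mu nu = rowlen mu i - rowlen nu j.
Proof.
move=> rr; have occ s := rows_occ s rr; case: (rr) => ij out mid top.
rewrite /wd (_ : [set c | _] = [set c : 'I_(n - k) | rowlen nu j <= c < rowlen mu i]).
  by rewrite card_ord_interval // rowlen_le.
apply/setP => c; rewrite !inE; apply/existsP/idP => [[r]|/andP[h1 h2]].
  rewrite in_skewE => h; have ro : i <= r <= j by rewrite -occ; lia.
  have := @rowlen_anti _ _ nu r j; have := @rowlen_anti _ _ mu i r; lia.
(* The topmost such row contains column [c]: by minimality [c] lies left of the end of row [r - 1]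
   of [nu], and row [r] of [mu] reaches one column further than that end. *)
have ex : exists r, (i <= r) && (rowlen nu r <= c) by exists j; rewrite h1; lia.
case: (ex_minnP ex) => r /andP[ir hr] mn.
have rj : r <= j by apply: mn; rewrite h1; lia.
have rk : r < k by lia.
exists (Ordinal rk); rewrite in_skewE /= hr /=.
have [->//|nri] := eqVneq r i.
have := mid r.-1; rewrite prednK; last by lia.
by have := mn r.-1; lia.
Qed.

Lemma ribbon_occ mu nu : is_ribbon mu nu -> exists r : 'I_k, row_occ mu nu r.
Proof.
case/and4P=> _ /existsP[[r c]] h _ _; exists r.
by move: h; rewrite in_skewE row_occE; lia.
Qed.

Lemma ribbon_head mu nu : is_ribbon mu nu -> exists i, head_row mu nu i.
Proof.
case/ribbon_occ=> r0 h0; case: (arg_minnP (fun r : 'I_k => r : nat) h0) => r h mn.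
exists r; rewrite /head_row h; apply/forallP => s; apply/implyP => sr.
by apply/negP => /mn; lia.
Qed.

Lemma ribbon_tail mu nu : is_ribbon mu nu -> exists j, tail_row mu nu j.
Proof.
case/ribbon_occ=> r0 h0; case: (arg_maxnP (fun r : 'I_k => r : nat) h0) => r h mn.
exists r; rewrite /tail_row h; apply/forallP => s; apply/implyP => sr.
by apply/negP => /mn; lia.
Qed.

Lemma ribbon_rowsP mu nu (i j : 'I_k) :
  is_ribbon mu nu -> head_row mu nu i -> tail_row mu nu j -> ribbon_rows i j nu mu.
Proof.
case/and4P=> /forallP sub _ /forallP conn /forallP nosq.
case/andP=> iocc /forallP itop /andP[jocc /forallP jbot].
move: (iocc) (jocc); rewrite !row_occE => iocc' jocc'.
have ij : i <= j.
  by rewrite leqNgt; apply/negP => /(implyP (itop j)); rewrite jocc.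
split=> //; first by rewrite ij ltn_ord.
- move=> r h; have [rk|rk] := ltnP r k; last by rewrite !rowlen_default.
  have := sub (Ordinal rk); rewrite -!rowlen_ord /= => le.
  suff : ~~ row_occ mu nu (Ordinal rk) by rewrite row_occE /=; lia.
  by case/orP: h => h; [apply: (implyP (itop _)) | apply: (implyP (jbot _))].
- move=> r /andP[ir rj].
  have rk : r < k by have := ltn_ord j; lia.
  have rSk : r.+1 < k by have := ltn_ord j; lia.
  apply/eqP; rewrite eqn_leq; apply/andP; split.
    (* A longer row [r + 1] would form a square with row [r] in columns [rowlen nu r] and its
       successor. *)
    rewrite leqNgt; apply/negP => h.
    have c1 : rowlen nu r < n - k by have := rowlen_le mu r.+1; lia.
    have c2 : (rowlen nu r).+1 < n - k by have := rowlen_le mu r.+1; lia.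
    have /forallP/(_ (Ordinal rSk, Ordinal c2)) := nosq (Ordinal rk, Ordinal c1).
    rewrite /= !eqxx /= !in_skewE /=.
    have := @rowlen_anti _ _ nu r r.+1; have := @rowlen_anti _ _ mu r r.+1; lia.
  rewrite ltnNge; apply/negP => h.
  have ci : rowlen nu i < n - k by have := rowlen_le mu i; lia.
  have cj : rowlen nu j < n - k by have := rowlen_le mu j; lia.
  have /forallP/(_ (j, Ordinal cj)) := conn (i, Ordinal ci).
  rewrite !in_skewE /= !leqnn iocc' jocc' /= => cij.
  (* With no shared column, adjacency never crosses from row [r] to row [r + 1], which separates
     head from tail. *)
  have cl : closed (skew_rel mu nu) [pred x : cell n k | x.1 <= r].
    move=> [r1 c1] [r2 c2] /and3P[]; rewrite !in_skewE => h1 h2.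
    rewrite /cell_adj !inE /= => /orP[/andP[/eqP-> _]//|/andP[/eqP e12 adj]].
    rewrite e12 in h1.
    case/orP: adj => /eqP e; apply/idP/idP => l; try lia.
      have [e1|//] : r1 = r :> nat \/ r2 <= r by lia.
      by move: h1 h2; rewrite -e e1; lia.
    have [e1|//] : r2 = r :> nat \/ r1 <= r by lia.
    by move: h1 h2; rewrite -e e1; lia.
  by have := closed_connect cl cij; rewrite !inE /=; lia.
Qed.

Lemma cnt_eq nu y c : (forall r, (site nu r < y) = (r < c)) -> cnt nu y = c.
Proof.
move=> h; have := h (cnt nu y); have := h c; rewrite !site_lt_cnt; lia.
Qed.

Hypothesis hkn : k <= n.

Lemma hop_rows a b nu mu :
  hop a b nu mu -> ribbon_rows (cnt nu b) (cnt nu a) nu mu.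
Proof.
move=> hp; have [ij lo hi mid] := hop_sites hkn hp.
have rl (la : part n k) r := rowlen_le la r.
split=> //.
- move=> r /orP[/lo|/hi]; rewrite /site; have := rl mu r; have := rl nu r; lia.
- move=> r /mid; rewrite /site; have := rl mu r.+1; have := rl nu r; lia.
- have := hop_site_target hkn hp; have := site_lt_cnt nu (cnt nu b) b.
  have ne : site nu (cnt nu b) != b.
    apply/eqP => e; have := cnt_siteS nu (cnt nu b); rewrite e.
    case/hopP: hp => // ba an h; have := h b; have := h b.+1.
    have := cnt_leS mu b; lia.
  rewrite ltnn => h1 h2; move: h1 h2 ne; rewrite /site; lia.
Qed.

Lemma rows_hop i j nu mu :
  ribbon_rows i j nu mu -> hop (site nu j) (site mu i) nu mu.
Proof.
case=> ij out mid top.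
have rl (la : part n k) r := rowlen_le la r.
have out' r : (r < i) || (j < r) -> site mu r = site nu r by rewrite /site => /out->.
have mid' r : i <= r < j -> site mu r.+1 = site nu r.
  by move=> /mid; rewrite /site; have := rl mu r.+1; lia.
have top' : site mu i < site nu i by move: top; rewrite /site; have := rl mu i; lia.
have nuij : site nu i <= site nu j by rewrite leqNgt site_lt; lia.
apply/hopP => //; split; [lia | by rewrite site_lt_n //; lia|].
(* Row by row: rows outside [i..j] keep their sites, rows after [i] up to [j] take over the site of
   the row above, and row [i] gets the target. *)
move=> y; apply: cnt_eq => r.
have Cj := site_lt_cnt nu j y; have Ci := site_lt_cnt nu i y.
have [lti|gei] := ltnP r i.
  have := site_lt mu r i; have := site_lt nu r i; have := site_lt_cnt nu r y.
  rewrite out' ?lti //; lia.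
have [ltj|gej] := ltnP j r.
  have := site_lt nu j r; have := site_lt_cnt nu r y.
  rewrite out' ?ltj ?orbT //; lia.
have [->|nri] := eqVneq r i.
  have [e|i_gt0] := posnP i; first lia.
  have := site_lt mu i.-1 i; have := site_lt_cnt nu i.-1 y.
  rewrite out' ?prednK ?leqnn //; lia.
have := mid' r.-1; rewrite prednK; last by lia.
have := site_lt_cnt nu r.-1 y; have := site_lt mu i r; have := site_lt nu r.-1 j.
lia.
Qed.

Lemma ribbon_hopP mu nu (i j : 'I_k) :
  is_ribbon mu nu -> head_row mu nu i -> tail_row mu nu j ->
  hop (site nu j) (site mu i) nu mu.
Proof. by move=> h1 h2 h3; apply/rows_hop/ribbon_rowsP. Qed.

Lemma hop_ribbon a b nu mu : hop a b nu mu -> is_ribbon mu nu.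
Proof. by move/hop_rows/rows_ribbon. Qed.

Lemma hop_head a b nu mu (i : 'I_k) : hop a b nu mu ->
  head_row mu nu i = (site mu i == b).
Proof.
move=> hp; rewrite (rows_head _ (hop_rows hp)); apply/eqP/eqP => [->|e].
  exact: hop_site_target hp.
by case/hopP: hp => // _ _ h; have := h b; rewrite ltnn addn0 -e cnt_site.
Qed.

Lemma hop_tail a b nu mu (j : 'I_k) : hop a b nu mu ->
  tail_row mu nu j = (site nu j == a).
Proof.
move=> hp; rewrite (rows_tail _ (hop_rows hp)); apply/eqP/eqP => [->|<-].
  exact: hop_site_source hp.
by rewrite cnt_site.
Qed.

(** The counts of [nu] and [mu] differ exactly on [b < y <= a], which determines both ends. *)
Lemma hop_unique a b a' b' nu mu : hop a b nu mu -> hop a' b' nu mu -> a = a' /\ b = b'.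
Proof.
case/hopP=> // ba an h /hopP[] // ba' an' h'.
have := h a; have := h a.+1; have := h' a; have := h' a.+1.
have := h b; have := h b.+1; have := h' b; have := h' b.+1.
have := h a'; have := h a'.+1; have := h' a'; have := h' a'.+1.
have := h b'; have := h b'.+1; have := h' b'; have := h' b'.+1.
lia.
Qed.

Lemma hop_hval a b nu mu : hop a b nu mu -> hval mu nu = n - b.
Proof.
move=> hp; rewrite /hval; case: pickP => [i|none].
  by rewrite (hop_head _ hp) => /eqP <-; rewrite -cval_site.
by have [i] := ribbon_head (hop_ribbon hp); rewrite none.
Qed.

Lemma hop_tval a b nu mu : hop a b nu mu -> Defs.tval mu nu = n - a.
Proof.
move=> hp; rewrite /Defs.tval; case: pickP => [i|none].
  by rewrite (hop_tail _ hp) => /eqP <-; rewrite -cval_site.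
by have [i] := ribbon_tail (hop_ribbon hp); rewrite none.
Qed.

Lemma hop_ht a b nu mu : hop a b nu mu -> ht mu nu = (cnt nu a - cnt nu b).+1.
Proof. by move/hop_rows/rows_ht. Qed.

(** The columns correspond to the holes of [nu] among the sites from [b] to [a - 1], the target [b]
    included. *)
Lemma hop_wd a b nu mu : hop a b nu mu -> wd mu nu = a - b - (cnt nu a - cnt nu b).
Proof.
move=> hp; rewrite (rows_wd (hop_rows hp)).
have := hop_site_target hkn hp; have := hop_site_source hkn hp.
rewrite /site; have := rowlen_le nu (cnt nu a); have := rowlen_le mu (cnt nu b).
case/hopP: hp => // ba an h; have := cnt_le nu (ltnW ba); lia.
Qed.

End RibbonRows.

(** * Operators as matrices *)

Section KernelMatrices.
Variables (T : finType) (R : pzRingType).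
Implicit Types (K L : T -> T -> R) (v : {ffun T -> R}).

(** Makes composition a ring product, so that [osym] applies; matrices act on row vectors from the
    right, so the leftmost factor acts first. *)
Definition kermat K : 'M[R]_#|T| := \matrix_(x, y) K (enum_val x) (enum_val y).
Definition rowof v : 'rV[R]_#|T| := \row_x v (enum_val x).

Lemma eq_kermat K L : K =2 L -> kermat K = kermat L.
Proof. by move=> KL; apply/matrixP => x y; rewrite !mxE KL. Qed.

Lemma kermatM K L : kermat K * kermat L = kermat (fun x y => \sum_z K x z * L z y).
Proof.
apply/matrixP => x y; rewrite !mxE.
rewrite (big_enum_val (fun z => K (enum_val x) z * L z (enum_val y))).
by apply: eq_bigr => z _; rewrite !mxE.
Qed.

Lemma kermat_sum (I : Type) (s : seq I) (P : pred I) (K : I -> T -> T -> R) :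
  \sum_(i <- s | P i) kermat (K i) = kermat (fun x y => \sum_(i <- s | P i) K i x y).
Proof. by apply/matrixP => x y; rewrite mxE summxE; apply: eq_bigr => i _; rewrite mxE. Qed.

Lemma kermat0 K : (forall x y, K x y = 0) -> kermat K = 0.
Proof. by move=> K0; apply/matrixP => x y; rewrite !mxE K0. Qed.

Lemma rowof_inj : injective rowof.
Proof.
move=> u v /rowP uv; apply/ffunP => x; have := uv (enum_rank x).
by rewrite !mxE enum_rankK.
Qed.

Lemma rowof_sum (I : Type) (s : seq I) (P : pred I) (V : I -> {ffun T -> R}) :
  rowof (\sum_(i <- s | P i) V i) = \sum_(i <- s | P i) rowof (V i).
Proof.
apply/rowP => x; rewrite mxE sum_ffunE summxE.
by apply: eq_bigr => i _; rewrite mxE.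
Qed.

Lemma rowof_kermat v K :
  rowof [ffun y => \sum_x v x * K x y] = rowof v *m kermat K.
Proof.
apply/rowP => y; rewrite !mxE ffunE.
rewrite (big_enum_val (fun z => v z * K z (enum_val y))).
by apply: eq_bigr => z _; rewrite !mxE.
Qed.

End KernelMatrices.

(** * Jump kernels and the exchange of heads and tails *)

Section Jumps.
Variables (n k : nat).
Hypothesis hkn : (k <= n)%N.
Variables (R : comPzRingType) (t : nat -> R).
Implicit Types (mu nu x y z : part n k).

(* The theorem only uses that the weight of a ribbon depends on the source and
   the target of the jump and on the number of particles jumped over. *)
Variable w : part n k -> part n k -> R.
Variable g : nat -> nat -> nat -> R.
Hypothesis wE : forall a b nu mu, hop a b nu mu -> w mu nu = g a b (cnt nu a - cnt nu b).

Definition occ nu a : bool := (cnt nu a < cnt nu a.+1)%N.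

Definition jump a b nu mu : R :=
  if a == b then (if (nu == mu) && occ nu a then t (n - a) else 0)
  else if hop a b nu mu then w mu nu else 0.

Lemma site_occ nu r : occ nu (site nu r).
Proof. by rewrite /occ cnt_site cnt_siteS. Qed.

Lemma occ_site nu a : occ nu a -> site nu (cnt nu a) = a.
Proof. by rewrite /occ => h; apply: site_eq => //; have := cnt_leS nu a; lia. Qed.

Lemma hop_occ a b nu mu : hop a b nu mu ->
  [/\ occ nu a, ~~ occ nu b, ~~ occ mu a & occ mu b].
Proof.
case/hopP=> // ba an h; rewrite /occ.
have := h a; have := h a.+1; have := h b; have := h b.+1.
have := cnt_leS nu a; have := cnt_leS mu a; have := cnt_leS nu b; have := cnt_leS mu b.
by split; lia.
Qed.

Lemma jump_source a b nu mu : ~~ occ nu a -> jump a b nu mu = 0.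
Proof.
move=> na; rewrite /jump (negbTE na) andbF.
by case: eqP => // _; case: ifP => // /hop_occ[]; rewrite (negbTE na).
Qed.

Lemma jump_target a b nu mu : ~~ occ mu b -> jump a b nu mu = 0.
Proof.
move=> nb; rewrite /jump; case: eqP => [->|_].
  by case: eqP => [->|//]; rewrite (negbTE nb).
by case: ifP => // /hop_occ[_ _ _]; rewrite (negbTE nb).
Qed.

(** Counts outside [b < s <= a] are invariants of the jump; they serve to compare row indices before
    and after it. *)
Lemma jump_cnt a b nu mu s : (s <= b)%N || (a < s)%N ->
  cnt mu s != cnt nu s -> jump a b nu mu = 0.
Proof.
move=> hs ne; rewrite /jump; case: ifP => _.
  by case: eqP => [e|//]; rewrite e eqxx in ne.
case: ifP => // /hopP[] // ba an h; case/eqP: ne; rewrite h; lia.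
Qed.

(** The first jump leaves [m] empty. *)
Lemma jump_same_source m b c x z y : (c < b <= m)%N -> jump m c x z * jump m b z y = 0.
Proof.
move=> h; rewrite {1}/jump; case: eqP => [|_]; first by lia.
case: ifP => [/hop_occ[_ _ nz _]|_]; last by rewrite mul0r.
by rewrite jump_source // mulr0.
Qed.

(** The first factor ends with [b] occupied, even when it is diagonal, while the second needs [b]
    empty. *)
Lemma jump_same_target m a b x z y : (b <= a < m)%N -> jump a b x z * jump m b z y = 0.
Proof.
move=> h; rewrite {2}/jump; case: eqP => [|_]; first by lia.
case: ifP => [/hop_occ[_ nz _ _]|_]; last by rewrite mulr0.
by rewrite jump_target // mul0r.
Qed.

Lemma sum_hop2 m c a b x z y : hop m c x z -> hop a b z y -> a != b ->
  \sum_z' jump m c x z' * jump a b z' y = w z x * w y z.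
Proof.
move=> h1 h2 ab; have mc : (m == c) = false by case/hopP: h1 => // ? ? _; lia.
rewrite (bigD1 z) //= big1 ?addr0.
  by rewrite /jump mc (negbTE ab) h1 h2.
move=> z' zz; rewrite /jump mc; case: ifP => [h3|_]; last by rewrite mul0r.
case/eqP: zz; apply: cnt_inj => s.
by case/hopP: h3 => // _ _ ->; case/hopP: h1 => // _ _ ->.
Qed.

Lemma sum_hop2_0 m c a b x y : m != c -> a != b ->
  (forall z, hop m c x z -> hop a b z y -> False) ->
  \sum_z jump m c x z * jump a b z y = 0.
Proof.
move=> mc ab no; apply: big1 => z _; rewrite /jump (negbTE mc) (negbTE ab).
case: ifP => [h1|_]; last by rewrite mul0r.
case: ifP => [h2|_]; last by rewrite mulr0.
by case: (no z).
Qed.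

Lemma jump_nested m a b c x y : (c < b)%N -> (b <= a)%N -> (a < m)%N ->
  \sum_z jump m c x z * jump a b z y = \sum_z jump a b x z * jump m c z y.
Proof.
(* When [a = b] the inner factor is diagonal, and the outer jump does not change the occupancy of
   [b]. *)
move=> cb; rewrite leq_eqVlt => /orP[/eqP<- bm|ba am].
  rewrite (bigD1 y) //= big1 ?addr0 => [|z zy]; last first.
    by rewrite {2}/jump eqxx (negbTE zy) /= mulr0.
  rewrite [RHS](bigD1 x) //= [X in _ + X]big1 ?addr0 => [|z zx]; last first.
    by rewrite {1}/jump eqxx eq_sym (negbTE zx) /= mul0r.
  rewrite [jump b b y y]/jump [jump b b x x]/jump !eqxx /= mulrC.
  rewrite /jump; case: eqP => [|_]; first by lia.
  case hp: (hop m c x y); last by rewrite !mulr0.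
  case/hopP: hp => // cm mn h; congr (_ * _).
  suff -> : occ y b = occ x b by [].
  by rewrite /occ; have := h b; have := h b.+1; lia.
have mc : m != c by lia.
have ab : a != b by lia.
(* Both orders lead from [x] to [y] exactly under this combined count relation. The numbers passed
   agree: the outer jump shifts the counts at [a] and [b] equally, and the inner one fixes those at
   [m] and [c]. *)
case: (boolP [&& (m < n)%N & [forall s : 'I_n.+1,
    cnt y s == cnt x s + (c < s <= m) + (b < s <= a)]%N]).
  case/andP=> mn /forallP h.
  have {}h s : cnt y s = (cnt x s + (c < s <= m) + (b < s <= a))%N.
    case: (ltnP s n.+1) => sn; first exact/eqP/(h (Ordinal sn)).
    by rewrite !cnt_large; lia.
  have [[z h1 h2] [z' h3 h4]] := hop_nested hkn cb ba am mn h.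
  rewrite (sum_hop2 h1 h2) // (sum_hop2 h3 h4) // !(wE h1, wE h2, wE h3, wE h4) mulrC.
  case/hopP: h1 => // _ _ e1; case/hopP: h3 => // _ _ e3.
  by rewrite !e1 !e3; congr (g _ _ _ * g _ _ _); lia.
move=> no; rewrite !sum_hop2_0 //.
  move=> z /hopP[] // _ an h1 /hopP[] // _ mn h2.
  case/negP: no; rewrite mn; apply/forallP => s; rewrite h2 h1; lia.
move=> z /hopP[] // _ mn h1 /hopP[] // _ an h2.
by case/negP: no; rewrite mn; apply/forallP => s; rewrite h2 h1.
Qed.

Definition jumps_to b nu mu : R := \sum_(b <= a < n) jump a b nu mu.
Definition jumps_from a nu mu : R := \sum_(b < a.+1) jump a b nu mu.

Lemma jumps_to_from r :
  osym (fun b => kermat (jumps_to b)) n r = osym (fun a => kermat (jumps_from a)) n r.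
Proof.
have := @osym_targets_sources _ (fun a b => kermat (jump a b)) n r.
under eq_osym => b bn do rewrite kermat_sum.
under [in X in _ = X]eq_osym => a an do rewrite kermat_sum.
apply.
- move=> m b c h; rewrite kermatM kermat0 // => x y.
  by apply: big1 => z _; exact: jump_same_source.
- move=> m a b c cb ba am; rewrite !kermatM; apply: eq_kermat => x y.
  exact: jump_nested.
- move=> m a b h; rewrite kermatM kermat0 // => x y.
  by apply: big1 => z _; exact: jump_same_target.
Qed.

Definition kerA (rowcond : part n k -> part n k -> 'I_k -> bool) (i : 'I_k) nu mu : R :=
  (if nu == mu then t (cval nu i) else 0)
  + (if is_ribbon mu nu && rowcond mu nu i then w mu nu else 0).

(** The head row is the index of the target particle in the final configuration, so fixing the row
    fixes the target; [hop_unique] leaves one source. *)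
Lemma jumps_to_head (i : 'I_k) nu mu :
  jumps_to (site mu i) nu mu = kerA (@head_row n k) i nu mu.
Proof.
have sn : (site mu i < n)%N by rewrite site_lt_n.
rewrite /jumps_to big_ltn //; congr (_ + _).
  rewrite /jump eqxx; case: eqP => [->|//].
  by rewrite site_occ cval_site.
transitivity (\sum_((site mu i).+1 <= a < n)
                (if hop a (site mu i) nu mu then w mu nu else 0)).
  by apply: eq_big_nat => a h; rewrite /jump; case: eqP => //; lia.
case: ifP => [/andP[rib hd]|no].
  have [j tl] := ribbon_tail rib; have hp := ribbon_hopP hkn rib hd tl.
  have inr : site nu j \in index_iota (site mu i).+1 n.
    by case/hopP: (hp) => // ? ? _; rewrite mem_index_iota; lia.
  rewrite (bigD1_seq _ inr) ?iota_uniq //= hp big1 ?addr0 // => a ne.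
  by case: ifP => // /(hop_unique hkn hp)[e]; rewrite e eqxx in ne.
rewrite big1 // => a _; case: ifP => // hp; case/negP: no.
by rewrite (hop_ribbon hkn hp) (hop_head hkn _ hp) eqxx.
Qed.

(** Dually, the tail row is the index of the source particle in the initial configuration. *)
Lemma jumps_from_tail (j : 'I_k) nu mu :
  jumps_from (site nu j) nu mu = kerA (@tail_row n k) j nu mu.
Proof.
have sn : (site nu j < n)%N by rewrite site_lt_n.
rewrite /jumps_from big_ord_recr /= addrC; congr (_ + _).
  rewrite /jump eqxx; case: eqP => [->|//].
  by rewrite site_occ cval_site.
rewrite (eq_bigr (fun b : 'I_(site nu j) =>
    if hop (site nu j) b nu mu then w mu nu else 0)); last first.
  by move=> b _; rewrite /jump; case: eqP => //; have := ltn_ord b; lia.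
case: ifP => [/andP[rib tl]|no].
  have [i hd] := ribbon_head rib; have hp := ribbon_hopP hkn rib hd tl.
  have lt : (site mu i < site nu j)%N by case/hopP: hp.
  rewrite (bigD1 (Ordinal lt)) //= hp big1 ?addr0 // => b ne.
  case: ifP => // /(hop_unique hkn hp)[_ e]; case/eqP: ne; exact: val_inj.
rewrite big1 // => b _; case: ifP => // hp; case/negP: no.
by rewrite (hop_ribbon hkn hp) (hop_tail hkn _ hp) eqxx.
Qed.

Lemma sum_at_site (F : nat -> R) nu i : (i < k)%N ->
  \sum_(b < n) (if site nu i == b then F b else 0) = F (site nu i).
Proof.
move=> ik; have sn : (site nu i < n)%N by rewrite site_lt_n.
rewrite (bigD1 (Ordinal sn)) //= eqxx big1 ?addr0 // => b ne.
by case: eqP => // e; case/eqP: ne; apply: val_inj.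
Qed.

Lemma sum_over_ranks (c : R) nu b : (b < n)%N -> (~~ occ nu b -> c = 0) ->
  \sum_(i < k) (if site nu i == b then c else 0) = c.
Proof.
move=> bn c0; case: (boolP (occ nu b)) => ob; last first.
  by rewrite big1 ?c0 // => i _; case: ifP.
have sb := occ_site ob; have ik : (cnt nu b < k)%N by rewrite -(site_lt_n hkn nu) sb.
rewrite (bigD1 (Ordinal ik)) //= sb eqxx big1 ?addr0 // => i ne.
case: eqP => // e; case/eqP: ne; apply: val_inj => /=.
by rewrite -e cnt_site.
Qed.

Lemma heads_tails r :
  \sum_(S : {set 'I_k} | #|S| == r) \prod_(i <- incr S) kermat (kerA (@head_row n k) i) =
  \sum_(S : {set 'I_k} | #|S| == r) \prod_(i <- incr S) kermat (kerA (@tail_row n k) i).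
Proof.
(* Row operators are split by site: the guard reads the final configuration for heads and the
   initial one for tails. *)
pose QH i b := kermat (fun nu mu => if site mu i == b then jumps_to b nu mu else 0).
pose QT i a := kermat (fun nu mu => if site nu i == a then jumps_from a nu mu else 0).
rewrite (osym_ord (f := fun i => \sum_(b < n) QH i b)); last first.
  move=> i; rewrite kermat_sum; apply: eq_kermat => nu mu.
  by rewrite (sum_at_site (fun b => jumps_to b nu mu)) // jumps_to_head.
rewrite (osym_ord (f := fun i => \sum_(a < n) QT i a)); last first.
  move=> i; rewrite kermat_sum; apply: eq_kermat => nu mu.
  by rewrite (sum_at_site (fun a => jumps_from a nu mu)) // jumps_from_tail.
rewrite !osym_exchange.
- transitivity (osym (fun b => kermat (jumps_to b)) n r).
    apply: eq_osym => b bn; rewrite kermat_sum; apply: eq_kermat => nu mu.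
    apply: sum_over_ranks => // nb; apply: big1 => a _; exact: jump_target.
  rewrite jumps_to_from.
  apply: eq_osym => a an; rewrite kermat_sum; apply: eq_kermat => nu mu.
  apply/esym/sum_over_ranks => // nb; apply: big1 => b _; exact: jump_source.
(* Tails: a jump from [a1] preserves the count at [a1 + 1], so in [z] the order of [a1] and [a2]
   must match that of [j1] and [j2]. *)
- move=> j1 a1 j2 a2 ne; rewrite kermatM kermat0 // => x y; apply: big1 => z _.
  case: eqP => [e1|_]; last by rewrite mul0r.
  case: eqP => [e2|_]; last by rewrite mulr0.
  suff -> : jumps_from a1 x z = 0 by rewrite mul0r.
  apply: big1 => b _; apply: (@jump_cnt _ _ _ _ a1.+1); first by rewrite ltnSn orbT.
  have := cnt_siteS x j1; rewrite e1 => ->.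
  have := cnt_site z j2; have := cnt_siteS z j2; rewrite e2 => h1 h2.
  case: (ltnP a1 a2) ne => h ne.
    by have := cnt_le z h; lia.
  by have := @cnt_le _ _ z a2.+1 a1.+1; lia.
(* Heads: a jump to [b2] preserves all counts up to [b2], which forces the same agreement of
   orders. *)
- move=> i1 b1 i2 b2 ne; rewrite kermatM kermat0 // => x y; apply: big1 => z _.
  case: eqP => [e1|_]; last by rewrite mul0r.
  case: eqP => [e2|_]; last by rewrite mulr0.
  suff -> : jumps_to b2 z y = 0 by rewrite mulr0.
  rewrite /jumps_to big_nat; apply: big1 => a _.
  have := cnt_site z i1; have := cnt_siteS z i1; rewrite e1 => h1 h2.
  have := cnt_site y i2; rewrite e2 => h3.
  case: (ltnP b1 b2) ne => h ne.
    apply: (@jump_cnt _ _ _ _ b1.+1); first by rewrite h.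
    by have := cnt_le y h; lia.
  apply: (@jump_cnt _ _ _ _ b2); first by rewrite leqnn.
  by have := cnt_le z h; lia.
Qed.

Lemma rowof_opA rc i v : rowof (opA t rc w i v) = rowof v *m kermat (kerA rc i).
Proof. exact: rowof_kermat. Qed.

Lemma rowof_opB rc i v : rowof (opB t rc w i v) = rowof v *m (kermat (kerA rc i))^T.
Proof.
rewrite (_ : _^T = kermat (fun x y => kerA rc i y x)); last first.
  by apply/matrixP => x y; rewrite !mxE.
rewrite -rowof_kermat; congr rowof; apply/ffunP => la; rewrite !ffunE.
apply: eq_bigr => nu _; congr (_ * (_ + _)).
by rewrite eq_sym; case: eqP => [->|].
Qed.

Lemma rowof_sumA rc r la : rowof (sumA (opA t rc w) r la) =
  rowof (basis R la) *m
  \sum_(S : {set 'I_k} | #|S| == r) \prod_(i <- incr S) kermat (kerA rc i).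
Proof.
rewrite rowof_sum mulmx_sumr; apply: eq_bigr => S _.
elim: (incr S) (basis R la) => [|i s IH] v /=; first by rewrite big_nil mulmx1.
by rewrite IH rowof_opA big_cons mulmxA.
Qed.

(** Transposition reverses products, matching the order in which [sumB] applies its factors. *)
Lemma rowof_sumB rc r mu : rowof (sumB (opB t rc w) r mu) =
  rowof (basis R mu) *m
  (\sum_(S : {set 'I_k} | #|S| == r) \prod_(i <- incr S) kermat (kerA rc i))^T.
Proof.
rewrite rowof_sum linear_sum /= mulmx_sumr; apply: eq_bigr => S _.
elim: (incr S) => [|i s IH] /=; first by rewrite big_nil trmx1 mulmx1.
by rewrite rowof_opB IH big_cons [(_ * _)^T]trmx_mul mulmxA.
Qed.

Lemma sumA_heads_tails r la :
  sumA (opA t (@head_row n k) w) r la = sumA (opA t (@tail_row n k) w) r la.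
Proof. by apply: rowof_inj; rewrite !rowof_sumA heads_tails. Qed.

Lemma sumB_heads_tails r mu :
  sumB (opB t (@head_row n k) w) r mu = sumB (opB t (@tail_row n k) w) r mu.
Proof. by apply: rowof_inj; rewrite !rowof_sumB heads_tails. Qed.

End Jumps.

Theorem theoremA1 (R : comPzRingType) (p q hb : R) (t : nat -> R) (n k : nat)
  (hkn : (k <= n)%N) (la mu : part n k) (r : nat) (hr : (r <= k)%N) :
  [/\ sumA (A_hh p q hb t) r la = sumA (A_th p q hb t) r la,
      sumA (A_ht p q hb t) r la = sumA (A_tt p q hb t) r la,
      sumB (B_hh p q hb t) r mu = sumB (B_th p q hb t) r mu &
      sumB (B_ht p q hb t) r mu = sumB (B_tt p q hb t) r mu].
Proof.
(* [u] selects the index of [t], from the target for [w_h] and from the source for [w_t]; [N] is the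
   height minus one. *)
pose g (u : nat -> nat -> nat) a b N : R :=
  (hb - (p - q) * t (u a b)) * p ^+ N * q ^+ (a - b - N).-1.
have wh a b (nu la' : part n k) : hop a b nu la' ->
    w_h p q hb t la' nu = g (fun _ b => n - b)%N a b (cnt nu a - cnt nu b)%N.
  by move=> hp; rewrite /w_h (hop_hval hkn hp) (hop_ht hkn hp) (hop_wd hkn hp).
have wt a b (nu la' : part n k) : hop a b nu la' ->
    w_t p q hb t la' nu = g (fun a _ => n - a)%N a b (cnt nu a - cnt nu b)%N.
  by move=> hp; rewrite /w_t (hop_tval hkn hp) (hop_ht hkn hp) (hop_wd hkn hp).
split.
- exact: (sumA_heads_tails hkn t wh).
- exact: (sumA_heads_tails hkn t wt).
- exact: (sumB_heads_tails hkn t wh).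
- exact: (sumB_heads_tails hkn t wt).
Qed.
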